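(* Let $a_1,a_2,a_3>0$ and $$A=\begin{bmatrix}0&a_1&0&0\\ a_1^{-1}&0&a_2&0\\ 0&a_2^{-1}&0&a_3\\ 0&0&a_3^{-1}&0\end{bmatrix}.$$ Put $A_j=\frac{a_j^2+a_j^{-2}}{2}$ $(\geq1)$ for $j=1,2,3$. Then $W(A)$ is bi-elliptical if and only if $A_1=A_3>1$ (equivalently: $a_1=a_3\neq1$ or $a_1=a_3^{-1}\neq1$) and $A_2=1$ (equivalently: $a_2=1$).
   Context: The numerical range of $A\in\mathbb{C}^{n\times n}$ is $W(A)=\{\langle Ax,x\rangle: x\in\mathbb{C}^n,\ \|x\|=1\}$. $W(A)$ is called bi-elliptical if it is the convex hull of two (non-degenerate) ellipses with distinct centers, neither of which is contained in the convex hull of the other (so that $W(A)$ is not simply an elliptical disk). Circles count as ellipses. *)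

(* Defs.v *)
From mathcomp Require Import all_boot all_order all_algebra.
From mathcomp Require Export complex.
From mathcomp Require Import classical_sets reals convex.
Set Implicit Arguments.
Unset Strict Implicit.
Unset Printing Implicit Defensive.
Import Order.TTheory GRing.Theory Num.Theory.

Local Open Scope classical_set_scope.
Local Open Scope ring_scope.
Local Open Scope complex_scope.

(* The complex numbers are R[i] for an arbitrary R : realType. *)
Section NumericalRange.
Variable R : realType.
Local Notation C := R[i].

(* dotmx acts on row vectors; it is linear in its first argument and
   conjugate-linear in the second. *)
Definition cdot (n : nat) (x y : 'cV[C]_n) : C := dotmx x^T y^T.

Definition cnorm (n : nat) (x : 'cV[C]_n) : C := sqrtC (cdot x x).

Definition numerical_range (n : nat) (A : 'M[C]_n) : set C :=
  [set cdot (A *m x) x | x in [set x : 'cV[C]_n | cnorm x = 1]].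

(* Rcomplex R is C with its structure of vector space over R. *)
Definition convex_hull (S : set C) : set C :=
  smallest (@convex_set R (Rcomplex R)) S.

(* The curve, not the disk: c is the center, p and q are the semi-axes, and the
   unit complex number u gives the direction of the axis of half-length p. *)
Definition ellipse (c u : C) (p q : R) : set C :=
  [set c + u * w |
    w in [set w : C | (complex.Re w / p) ^+ 2 + (complex.Im w / q) ^+ 2 = 1]].

Definition ellipse_with_center (c : C) (E : set C) : Prop :=
  exists (u : C) (p q : R),
    [/\ `|u| = 1, 0 < p, 0 < q & E = ellipse c u p q].

Definition bi_elliptical (W : set C) : Prop :=
  exists (E1 E2 : set C) (c1 c2 : C),
    [/\ ellipse_with_center c1 E1, ellipse_with_center c2 E2 & c1 <> c2] /\
    [/\ ~ (E1 `<=` convex_hull E2), ~ (E2 `<=` convex_hull E1)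
      & W = convex_hull (E1 `|` E2)].

Definition reciprocal_mx (a1 a2 a3 : R) : 'M[C]_4 :=
  \matrix_(i < 4, j < 4)
    (nth 0 (nth [::]
      [:: [:: 0;     a1;    0;     0 ];
          [:: a1^-1; 0;     a2;    0 ];
          [:: 0;     a2^-1; 0;     a3];
          [:: 0;     0;     a3^-1; 0 ]] i) j)%:C.

End NumericalRange.

(* Main.v *)
(* Write b_j = (A_j + cos (2 th)) / 2. The support function h of W(A) in direction
   th depends only on the moduli of the entries of Re (e^{-i th} A), and
   h^4 - (b_1 + b_2 + b_3) h^2 + b_1 b_3 = 0.

   If W(A) is the hull of two ellipses, one of them has a center c <> 0, and h
   coincides on an open set of directions with its support function u + sqrt Q
   (u a nonzero linear form, Q a positive definite quadratic form). As Q is not a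
   square, this forces b_1 + b_2 + b_3 = 2 (u^2 + Q) and b_1 b_3 = (u^2 - Q)^2 as
   forms. Since b_1 b_3 is a square, A_1 = A_3; then u^2 is b_2 / 4 or
   b_1 + b_2 / 4, it has rank one, and the second possibility would make Q
   degenerate. So A_2 = 1, and Q = b_1 + b_2 / 4 gives A_1 > 1.

   Conversely, conjugating one product x_{j+1} conj(x_j) shows that a_1 may be
   replaced by its inverse. If a_1 a_3 = 1 and a_2 = 1, then A is unitarily similar
   to the direct sum of [0, a_1; 1/a_1, 1] and [0, a_1; 1/a_1, -1], whose numerical
   ranges are two translates, centered at 1/2 and -1/2, of one elliptical disk. *)
Require Import Defs.
From mathcomp Require Import all_boot all_order all_algebra.
From mathcomp Require Import reals.
From mathcomp Require Import boolp classical_sets convex interval_inference.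
From mathcomp Require Import ring lra.
Import Order.TTheory GRing.Theory Num.Theory.
Local Open Scope ring_scope.
Local Open Scope complex_scope.

(** * Convex hulls and the numerical range in real coordinates *)

Section Hull.
Variable R : realType.
Implicit Types (S : set R[i]) (x y t : R) (P : R -> R -> Prop).

Lemma sub_convex_hull S : (S `<=` convex_hull S)%classic.
Proof. exact: sub_smallest. Qed.

Lemma convex_hull_conv S x y x' y' t : 0 <= t <= 1 ->
  convex_hull S (x +i* y) -> convex_hull S (x' +i* y') ->
  convex_hull S ((t * x + (1 - t) * x') +i* (t * y + (1 - t) * y')).
Proof.
move=> t01 Hz Hw B [cB SB].
have /mem_set Bz := Hz B (conj cB SB); have /mem_set Bw := Hw B (conj cB SB).
have := cB _ _ (Itv01 (proj1 (andP t01)) (proj2 (andP t01))) Bz Bw.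
by move/set_mem; congr B.
Qed.

Lemma convex_hull_min S P :
  (forall x y x' y' t, 0 <= t <= 1 -> P x y -> P x' y' ->
     P (t * x + (1 - t) * x') (t * y + (1 - t) * y')) ->
  (forall x y, S (x +i* y) -> P x y) ->
  forall x y, convex_hull S (x +i* y) -> P x y.
Proof.
move=> cP SP x y /(_ [set z | P (complex.Re z) (complex.Im z)]%classic); apply.
split=> [[a b] [c d] l /set_mem /= Hz /set_mem /= Hw|[a b] /SP //].
apply/mem_set => /=.
have : 0 <= l%:num <= 1 by rewrite ge0 le1.
by move/(cP _ _ _ _ _)/(_ Hz Hw).
Qed.
End Hull.

(* Membership of x + i y in the numerical range, with k_j = a_j + 1 / a_j,
   l_j = a_j - 1 / a_j and the unit vector of coordinates p_j + i q_j. *)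
Definition nr4 {R : realType} (k1 k2 k3 l1 l2 l3 : R) (x y : R) : Prop :=
  exists p1 q1 p2 q2 p3 q3 p4 q4 : R,
  [/\ p1 ^+ 2 + q1 ^+ 2 + p2 ^+ 2 + q2 ^+ 2 + p3 ^+ 2 + q3 ^+ 2
        + p4 ^+ 2 + q4 ^+ 2 = 1,
      x = k1 * (p2 * p1 + q2 * q1) + k2 * (p3 * p2 + q3 * q2)
          + k3 * (p4 * p3 + q4 * q3)
    & y = l1 * (q2 * p1 - p2 * q1) + l2 * (q3 * p2 - p3 * q2)
          + l3 * (q4 * p3 - p4 * q3)].

Lemma cdot_col4 (R : realType) (u v : nat -> R[i]) :
  cdot (\col_(i < 4) u i) (\col_(i < 4) v i) =
  u 0%N * (v 0%N)^*%C + u 1%N * (v 1%N)^*%C + u 2%N * (v 2%N)^*%C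
    + u 3%N * (v 3%N)^*%C.
Proof.
rewrite /cdot dotmxE mxE !big_ord_recr big_ord0 /= !mxE /=.
by rewrite add0r.
Qed.

Lemma reciprocal_mx_col4 (R : realType) (a1 a2 a3 : R) (u : nat -> R[i]) :
  reciprocal_mx a1 a2 a3 *m (\col_(i < 4) u i) =
  \col_(i < 4) (nth 0 [:: a1%:C * u 1%N; a1^-1%:C * u 0%N + a2%:C * u 2%N;
     a2^-1%:C * u 1%N + a3%:C * u 3%N; a3^-1%:C * u 2%N] i).
Proof.
apply/matrixP => i j; rewrite !mxE !big_ord_recr big_ord0 /= !mxE /=.
case: i => [[|[|[|[|i]]]] Hi] //=; by rewrite !mul0r ?add0r ?addr0.
Qed.

Lemma col4_ex (R : realType) (v : 'cV[R[i]]_4) :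
  exists p1 q1 p2 q2 p3 q3 p4 q4 : R,
   v = \col_(i < 4)
     nth 0 [:: p1 +i* q1; p2 +i* q2; p3 +i* q3; p4 +i* q4] i.
Proof.
case E1: (v (@inord 3 0) 0) => [p1 q1]; case E2: (v (@inord 3 1) 0) => [p2 q2].
case E3: (v (@inord 3 2) 0) => [p3 q3]; case E4: (v (@inord 3 3) 0) => [p4 q4].
exists p1, q1, p2, q2, p3, q3, p4, q4.
apply/matrixP => i j; rewrite !mxE ord1 -E1 -E2 -E3 -E4.
by case: i => [[|[|[|[|i]]]] Hi] //=; congr (v _ _); apply/val_inj; rewrite /= inordK.
Qed.

(** With z = x_{j+1} conj(x_j), the entries [a_j] and [a_j^-1] contribute a_j z + conj(z) / a_j,
    that is k_j Re z + i l_j Im z. *)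
Lemma numerical_rangeE (R : realType) (a1 a2 a3 x y : R) :
  numerical_range (reciprocal_mx a1 a2 a3) (x +i* y) <->
  nr4 (a1 + a1^-1) (a2 + a2^-1) (a3 + a3^-1)
      (a1 - a1^-1) (a2 - a2^-1) (a3 - a3^-1) x y.
Proof.
have normE (u : 'cV[R[i]]_4) : cnorm u = 1 <-> cdot u u = 1.
  rewrite /cnorm; split=> [H|->]; last exact: sqrtC1.
  by rewrite -[LHS]sqrtCK H expr1n.
rewrite /numerical_range /nr4; split.
- case=> u /= /normE; have [p1[q1[p2[q2[p3[q3[p4[q4 ->]]]]]]]] := col4_ex _ u.
  rewrite reciprocal_mx_col4 !cdot_col4 /=; simpc => -[N _] [<- <-].
  exists p1, q1, p2, q2, p3, q3, p4, q4; split; first (by rewrite -N; ring); ring.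
- case=> p1[q1[p2[q2[p3[q3[p4[q4 [N -> ->]]]]]]]].
  exists (\col_(i < 4)
     nth 0 [:: p1 +i* q1; p2 +i* q2; p3 +i* q3; p4 +i* q4] i) => /=.
    apply/normE; rewrite !cdot_col4 /=; simpc.
    by congr (_ +i* _); [rewrite -N; ring|ring].
  rewrite reciprocal_mx_col4 !cdot_col4 /=; simpc.
  congr (_ +i* _); ring.
Qed.

(** * Support functions of ellipses *)

Lemma ellipseE (R : realType) (c1 c2 u1 u2 p q x y : R) :
  ellipse (c1 +i* c2) (u1 +i* u2) p q (x +i* y) <->
  exists w1 w2 : R, [/\ (w1 / p) ^+ 2 + (w2 / q) ^+ 2 = 1,
    x = c1 + (u1 * w1 - u2 * w2) & y = c2 + (u1 * w2 + u2 * w1)].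
Proof.
rewrite /ellipse; split.
- by case=> -[w1 w2] /= H; simpc=> -[<- <-]; exists w1, w2.
- by case=> w1 [w2 [H -> ->]]; exists (w1 +i* w2) => //; simpc.
Qed.

(* The square of the half-width, in direction (al, be), of an ellipse. *)
Definition width2 {R : realType} (u1 u2 p q al be : R) : R :=
  p ^+ 2 * (al * u1 + be * u2) ^+ 2 + q ^+ 2 * (al * u2 - be * u1) ^+ 2.

Section Ellipse.
Variables (R : realType) (c1 c2 u1 u2 p q : R).
Hypotheses (u_unit : u1 ^+ 2 + u2 ^+ 2 = 1) (p_gt0 : 0 < p) (q_gt0 : 0 < q).
Local Notation E := (ellipse (c1 +i* c2) (u1 +i* u2) p q).
Local Notation Q := (width2 u1 u2 p q).

(** The point lies on a chord parallel to the axis of half-length [p], whose ends, at first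
    coordinate [m * p] and [- (m * p)], are on the curve. *)
Lemma disk_sub_hull w1 w2 : (w1 / p) ^+ 2 + (w2 / q) ^+ 2 <= 1 ->
  convex_hull E ((c1 + (u1 * w1 - u2 * w2)) +i* (c2 + (u1 * w2 + u2 * w1))).
Proof.
move=> Hw.
set m := Num.sqrt (1 - (w2 / q) ^+ 2).
have m2 : m ^+ 2 = 1 - (w2 / q) ^+ 2.
  by rewrite sqr_sqrtr // subr_ge0 (le_trans _ Hw) // lerDr sqr_ge0.
have m_ge0 : 0 <= m := sqrtr_ge0 _.
have Em s : s ^+ 2 = 1 -> E ((c1 + (u1 * (s * m * p) - u2 * w2)) +i*
                             (c2 + (u1 * w2 + u2 * (s * m * p)))).
  move=> s2; apply/ellipseE; exists (s * m * p), w2; split=> //.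
  by rewrite mulfK ?gt_eqF // exprMn s2 mul1r m2 subrK.
have [m0|m_neq0] := eqVneq m 0.
  have w1_0 : w1 = 0.
    have : (w1 / p) ^+ 2 <= 0 by move: m2; rewrite m0 expr0n /= => ?; lra.
    rewrite le_eqVlt ltNge sqr_ge0 orbF sqrf_eq0 mulf_eq0 invr_eq0.
    by rewrite (gt_eqF p_gt0) orbF => /eqP.
  have := Em 1 (expr1n _ _); rewrite m0 mulr0 mul0r w1_0.
  exact: sub_convex_hull.
have m_gt0 : 0 < m by rewrite lt_def m_neq0.
have mp_gt0 : 0 < m * p by rewrite mulr_gt0.
have Hle : w1 ^+ 2 <= (m * p) ^+ 2.
  rewrite exprMn -ler_pdivrMr ?exprn_gt0 // -expr_div_n m2; lra.
have /andP[Hl Hr] : - (m * p) <= w1 <= m * p.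
  by rewrite -ler_norml -[m * p]gtr0_norm // -ler_sqr ?nnegrE // !real_normK ?num_real.
pose t := (1 + w1 / (m * p)) / 2.
have Et : w1 / (m * p) * (m * p) = w1 by rewrite divfK ?gt_eqF.
have t01 : 0 <= t <= 1.
  have H1 : -1 <= w1 / (m * p) by rewrite ler_pdivlMr // mulN1r.
  have H2 : w1 / (m * p) <= 1 by rewrite ler_pdivrMr // mul1r.
  rewrite /t; apply/andP; split; lra.
have N1_2 : (-1 : R) ^+ 2 = 1 by rewrite sqrrN expr1n.
have := convex_hull_conv _ _ _ _ _ _ _ t01 (sub_convex_hull _ _ _ (Em 1 (expr1n _ _)))
  (sub_convex_hull _ _ _ (Em (-1) N1_2)).
have Ew1 : w1 = (2 * t - 1) * (m * p).
  by rewrite -[LHS]Et /t; set r := w1 / _; field.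
have Ew (c a b : R) : t * (c + (a * (1 * m * p) + b))
    + (1 - t) * (c + (a * (-1 * m * p) + b)) = c + (a * w1 + b).
  by rewrite Ew1; ring.
have Ew' (c a b : R) : t * (c + (b + a * (1 * m * p)))
    + (1 - t) * (c + (b + a * (-1 * m * p))) = c + (b + a * w1).
  by rewrite Ew1; ring.
by rewrite Ew Ew'.
Qed.

Lemma width2_ge0 al be : 0 <= Q al be.
Proof. by rewrite /width2 addr_ge0 // mulr_ge0 ?sqr_ge0. Qed.

(** Cauchy-Schwarz in the axes of the ellipse; the defect is the square in Lagrange's identity. *)
Lemma ellipse_width_le x y al be : E (x +i* y) ->
  al * (x - c1) + be * (y - c2) <= Num.sqrt (Q al be).
Proof.
move=> /ellipseE[w1 [w2 [Hw -> ->]]].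
set v1 := al * u1 + be * u2; set v2 := al * u2 - be * u1.
have [Ep Eq] : w1 = w1 / p * p /\ w2 = w2 / q * q.
  by rewrite !divfK ?gt_eqF.
have -> : al * (c1 + (u1 * w1 - u2 * w2) - c1)
  + be * (c2 + (u1 * w2 + u2 * w1) - c2) =
   (w1 / p) * (p * v1) - (w2 / q) * (q * v2).
  by rewrite !mulrA -Ep -Eq /v1 /v2; ring.
apply: (le_trans (ler_norm _)).
rewrite -ler_sqr ?nnegrE ?sqrtr_ge0 // real_normK ?num_real // sqr_sqrtr ?width2_ge0 //.
rewrite /width2 -/v1 -/v2.
move: Hw; set a := w1 / p; set b := w2 / q => Hw.
rewrite -subr_ge0.
have -> : p ^+ 2 * v1 ^+ 2 + q ^+ 2 * v2 ^+ 2 - (a * (p * v1) - b * (q * v2)) ^+ 2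
  = (1 - (a ^+ 2 + b ^+ 2)) * (p ^+ 2 * v1 ^+ 2 + q ^+ 2 * v2 ^+ 2)
    + (a * (q * v2) + b * (p * v1)) ^+ 2 by ring.
by rewrite Hw subrr mul0r add0r sqr_ge0.
Qed.

Lemma hull_width_le x y al be : convex_hull E (x +i* y) ->
  al * (x - c1) + be * (y - c2) <= Num.sqrt (Q al be).
Proof.
move: x y; apply: convex_hull_min => [x y x' y' t /andP[t0 t1] H H'|x y].
  set s := Num.sqrt _ in H H' *.
  have -> : al * (t * x + (1 - t) * x' - c1) + be * (t * y + (1 - t) * y' - c2)
    = t * (al * (x - c1) + be * (y - c2))
      + (1 - t) * (al * (x' - c1) + be * (y' - c2)) by ring.
  have -> : s = t * s + (1 - t) * s by ring.
  by rewrite lerD // ler_wpM2l // subr_ge0.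
exact: ellipse_width_le.
Qed.

Lemma width2_gt0 al be : al != 0 -> 0 < Q al be.
Proof.
move=> al0; rewrite lt_def width2_ge0 andbT.
apply/eqP; rewrite /width2.
set v1 := al * u1 + be * u2; set v2 := al * u2 - be * u1 => Q0.
have [H1 H2] : p ^+ 2 * v1 ^+ 2 = 0 /\ q ^+ 2 * v2 ^+ 2 = 0.
  have := mulr_ge0 (sqr_ge0 p) (sqr_ge0 v1).
  have := mulr_ge0 (sqr_ge0 q) (sqr_ge0 v2); lra.
have v1_0 : v1 = 0.
  by apply/eqP; move/eqP: H1; rewrite mulf_eq0 !sqrf_eq0 (gt_eqF p_gt0).
have v2_0 : v2 = 0.
  by apply/eqP; move/eqP: H2; rewrite mulf_eq0 !sqrf_eq0 (gt_eqF q_gt0).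
move/negP: al0; apply; apply/eqP.
have -> : al = al * (u1 ^+ 2 + u2 ^+ 2) by rewrite u_unit mulr1.
have -> : al * (u1 ^+ 2 + u2 ^+ 2) = v1 * u1 + v2 * u2 by rewrite /v1 /v2; ring.
by rewrite v1_0 v2_0 !mul0r addr0.
Qed.

Lemma ellipse_width_attained al be : al != 0 ->
  exists x y : R, E (x +i* y) /\ al * (x - c1) + be * (y - c2) = Num.sqrt (Q al be).
Proof.
move=> al0; have Q_gt0 := width2_gt0 al be al0.
set s := Num.sqrt _; have s2 : s ^+ 2 = Q al be by rewrite sqr_sqrtr // ltW.
have s_neq0 : s != 0 by rewrite gt_eqF // sqrtr_gt0.
have [p0 q0] : p != 0 /\ q != 0 by rewrite !gt_eqF.
(* The contact point is the equality case of Cauchy-Schwarz. *)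
set w1 := p ^+ 2 * (al * u1 + be * u2) / s.
set w2 := - (q ^+ 2 * (al * u2 - be * u1) / s).
exists (c1 + (u1 * w1 - u2 * w2)), (c2 + (u1 * w2 + u2 * w1)); split.
  apply/ellipseE; exists w1, w2; split => //.
  have -> : (w1 / p) ^+ 2 + (w2 / q) ^+ 2 = Q al be / s ^+ 2.
    rewrite /w1 /w2 /width2; field; rewrite s_neq0 q0 p0 //.
  by rewrite s2 divff // gt_eqF.
have -> : al * (c1 + (u1 * w1 - u2 * w2) - c1) +
   be * (c2 + (u1 * w2 + u2 * w1) - c2) = Q al be / s.
  by rewrite /w1 /w2 /width2; field.
by rewrite -s2 expr2 mulfK.
Qed.

(** The direction is normal, at the given point, to the concentric homothetic ellipse through it.
    Scaled suitably, it makes both [v] and [Q al be] equal to [M], and [1 < M] gives M < M^2.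
    Squares instead of roots keep the condition polynomial in the direction. *)
Lemma ellipse_separation x y : ~ convex_hull E (x +i* y) ->
  exists al be : R, let v := al * (x - c1) + be * (y - c2) in
    0 < v /\ Q al be < v ^+ 2.
Proof.
set w1 := u1 * (x - c1) + u2 * (y - c2); set w2 := u1 * (y - c2) - u2 * (x - c1).
have [p0 q0] : p != 0 /\ q != 0 by rewrite !gt_eqF.
have Ex : x = c1 + (u1 * w1 - u2 * w2).
  rewrite /w1 /w2; have -> : u1 * (u1 * (x - c1) + u2 * (y - c2))
    - u2 * (u1 * (y - c2) - u2 * (x - c1)) = (u1 ^+ 2 + u2 ^+ 2) * (x - c1) by ring.
  by rewrite u_unit mul1r addrC subrK.
have Ey : y = c2 + (u1 * w2 + u2 * w1).
  rewrite /w1 /w2; have -> : u1 * (u1 * (y - c2) - u2 * (x - c1))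
    + u2 * (u1 * (x - c1) + u2 * (y - c2)) = (u1 ^+ 2 + u2 ^+ 2) * (y - c2) by ring.
  by rewrite u_unit mul1r addrC subrK.
have [Hle|Hgt _] := lerP ((w1 / p) ^+ 2 + (w2 / q) ^+ 2) 1.
  by case; rewrite Ex Ey; exact: disk_sub_hull.
exists (u1 * (w1 / p ^+ 2) - u2 * (w2 / q ^+ 2)),
       (u2 * (w1 / p ^+ 2) + u1 * (w2 / q ^+ 2)) => /=.
set M := _ + _ in Hgt.
have -> : (u1 * (w1 / p ^+ 2) - u2 * (w2 / q ^+ 2)) * (x - c1) +
   (u2 * (w1 / p ^+ 2) + u1 * (w2 / q ^+ 2)) * (y - c2) = M.
  have -> : M = w1 * (w1 / p ^+ 2) + w2 * (w2 / q ^+ 2).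
    by rewrite /M; field; rewrite q0 p0.
  transitivity ((u1 * (x - c1) + u2 * (y - c2)) * (w1 / p ^+ 2)
    + (u1 * (y - c2) - u2 * (x - c1)) * (w2 / q ^+ 2)); first by ring.
  by [].
have -> : Q (u1 * (w1 / p ^+ 2) - u2 * (w2 / q ^+ 2))
   (u2 * (w1 / p ^+ 2) + u1 * (w2 / q ^+ 2)) = (u1 ^+ 2 + u2 ^+ 2) ^+ 2 * M.
  by rewrite /M /width2; field; rewrite q0 p0.
rewrite u_unit expr1n mul1r; split; first by rewrite (lt_trans ltr01).
by rewrite expr2 ltr_pMl // (lt_trans ltr01).
Qed.
End Ellipse.

(** * The support function of the numerical range *)

(** The off-diagonal entries link the coordinates along a path, so the phases of the three products
    x_{j+1} conj(x_j) can be prescribed independently, turning each coordinate relative to the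
    previous one. *)
Lemma nr4_phase (R : realType) (k1 k2 k3 l1 l2 l3 : R)
    (r1 r2 r3 r4 c1 c2 c3 s1 s2 s3 : R) :
  c1 ^+ 2 + s1 ^+ 2 = 1 -> c2 ^+ 2 + s2 ^+ 2 = 1 -> c3 ^+ 2 + s3 ^+ 2 = 1 ->
  r1 ^+ 2 + r2 ^+ 2 + r3 ^+ 2 + r4 ^+ 2 = 1 ->
  nr4 k1 k2 k3 l1 l2 l3
    (k1 * (r1 * r2 * c1) + k2 * (r2 * r3 * c2) + k3 * (r3 * r4 * c3))
    (l1 * (r1 * r2 * s1) + l2 * (r2 * r3 * s2) + l3 * (r3 * r4 * s3)).
Proof.
move=> H1 H2 H3 Hr.
(* d + i e is the product of the unit numbers c + i s and c' + i s'. *)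
have rot (c s c' s' : R) : c ^+ 2 + s ^+ 2 = 1 -> c' ^+ 2 + s' ^+ 2 = 1 ->
    exists d e : R, [/\ d ^+ 2 + e ^+ 2 = 1, d * c + e * s = c' & e * c - d * s = s'].
  move=> H H'; exists (c * c' - s * s'), (c * s' + s * c'); split.
  - have -> : (c * c' - s * s') ^+ 2 + (c * s' + s * c') ^+ 2
      = (c ^+ 2 + s ^+ 2) * (c' ^+ 2 + s' ^+ 2) by ring.
    by rewrite H H' mulr1.
  - by rewrite -[RHS]mul1r -H; ring.
  - by rewrite -[RHS]mul1r -H; ring.
have [d2 [e2 [N2 <- <-]]] := rot _ _ _ _ H1 H2.
have [d3 [e3 [N3 <- <-]]] := rot _ _ _ _ N2 H3.
exists r1, 0, (r2 * c1), (r2 * s1), (r3 * d2), (r3 * e2), (r4 * d3), (r4 * e3).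
split; [|ring|ring].
rewrite -[RHS]Hr -[in RHS](mul1r (r2 ^+ 2)) -[in RHS](mul1r (r3 ^+ 2)).
by rewrite -[in RHS](mul1r (r4 ^+ 2)) -{1}H1 -{1}N2 -N3; ring.
Qed.

Lemma quadratic_ge0_linear_coef (R : realType) (a b : R) :
  (forall e, 0 <= a * e ^+ 2 + b * e) -> b = 0.
Proof.
move=> H; apply/eqP; apply/negP => /negP b0.
pose c := `|a| + 1.
have c0 : 0 < c by rewrite /c ltr_wpDl.
have ac : a <= c - 1 by rewrite /c addrK ler_norm.
(* Since a < c, the value at this point is negative unless b = 0. *)
have := H (- (b / c)).
have -> : a * (- (b / c)) ^+ 2 + b * - (b / c) = (a - c) * (b / c) ^+ 2.
  by field; rewrite gt_eqF.
have Hb : 0 < (b / c) ^+ 2 by rewrite lt_def sqr_ge0 sqrf_eq0 mulf_neq0 // invr_eq0 gt_eqF.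
rewrite pmulr_lge0 //; lra.
Qed.

(* [h] is the largest eigenvalue of the symmetric tridiagonal matrix with zero
   diagonal and off-diagonal entries g1 / 2, g2 / 2, g3 / 2. *)
Lemma tridiagonal_max_eigenvalue (R : realType) (g1 g2 g3 h r1 r2 r3 r4 : R) :
  (forall s1 s2 s3 s4, g1 * (s1 * s2) + g2 * (s2 * s3) + g3 * (s3 * s4)
      <= h * (s1 ^+ 2 + s2 ^+ 2 + s3 ^+ 2 + s4 ^+ 2)) ->
  r1 ^+ 2 + r2 ^+ 2 + r3 ^+ 2 + r4 ^+ 2 = 1 ->
  h <= g1 * (r1 * r2) + g2 * (r2 * r3) + g3 * (r3 * r4) ->
  16 * h ^+ 4 - 4 * (g1 ^+ 2 + g2 ^+ 2 + g3 ^+ 2) * h ^+ 2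
    + g1 ^+ 2 * g3 ^+ 2 = 0.
Proof.
move=> Hmax Hr Hh.
have E0 : g1 * (r1 * r2) + g2 * (r2 * r3) + g3 * (r3 * r4) = h.
  have := Hmax r1 r2 r3 r4; rewrite Hr mulr1; lra.
have Z : h * (r1 ^+ 2 + r2 ^+ 2 + r3 ^+ 2 + r4 ^+ 2)
    - (g1 * (r1 * r2) + g2 * (r2 * r3) + g3 * (r3 * r4)) = 0.
  by rewrite Hr E0 mulr1 subrr.
(* The difference of the two sides of [Hmax] is nonnegative and vanishes at [r], hence is stationary
   there; each coordinate yields one row of the eigenvector equation. *)
have E1 : 2 * h * r1 - g1 * r2 = 0.
  apply: (quadratic_ge0_linear_coef _ h) => e.
  have := Hmax (r1 + e) r2 r3 r4; rewrite -subr_ge0; congr (0 <= _).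
  by rewrite -[RHS]addr0 -Z; ring.
have E2 : 2 * h * r2 - g1 * r1 - g2 * r3 = 0.
  apply: (quadratic_ge0_linear_coef _ h) => e.
  have := Hmax r1 (r2 + e) r3 r4; rewrite -subr_ge0; congr (0 <= _).
  by rewrite -[RHS]addr0 -Z; ring.
have E3 : 2 * h * r3 - g2 * r2 - g3 * r4 = 0.
  apply: (quadratic_ge0_linear_coef _ h) => e.
  have := Hmax r1 r2 (r3 + e) r4; rewrite -subr_ge0; congr (0 <= _).
  by rewrite -[RHS]addr0 -Z; ring.
have E4 : 2 * h * r4 - g3 * r3 = 0.
  apply: (quadratic_ge0_linear_coef _ h) => e.
  have := Hmax r1 r2 r3 (r4 + e); rewrite -subr_ge0; congr (0 <= _).
  by rewrite -[RHS]addr0 -Z; ring.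
pose L := 2 * h; rewrite -/L in E1 E2 E3 E4.
set P := LHS.
(* [P] is the characteristic polynomial, at [L], of the matrix with off-diagonal entries [g1], [g2],
   [g3]. *)
have EP : P = L ^+ 4 - (g1 ^+ 2 + g2 ^+ 2 + g3 ^+ 2) * L ^+ 2
    + g1 ^+ 2 * g3 ^+ 2 by rewrite /P /L; ring.
(* Multiply the eigenvector equations by the adjugate of the matrix. *)
have P1 : P * r1 = 0.
  transitivity ((L ^+ 3 - (g2 ^+ 2 + g3 ^+ 2) * L) * (L * r1 - g1 * r2)
    + g1 * (L ^+ 2 - g3 ^+ 2) * (L * r2 - g1 * r1 - g2 * r3)
    + g1 * g2 * L * (L * r3 - g2 * r2 - g3 * r4)
    + g1 * g2 * g3 * (L * r4 - g3 * r3)); first by rewrite EP; ring.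
  by rewrite E1 E2 E3 E4 !mulr0 !addr0.
have P2 : P * r2 = 0.
  transitivity (g1 * (L ^+ 2 - g3 ^+ 2) * (L * r1 - g1 * r2)
    + L * (L ^+ 2 - g3 ^+ 2) * (L * r2 - g1 * r1 - g2 * r3)
    + g2 * L ^+ 2 * (L * r3 - g2 * r2 - g3 * r4)
    + L * g2 * g3 * (L * r4 - g3 * r3)); first by rewrite EP; ring.
  by rewrite E1 E2 E3 E4 !mulr0 !addr0.
have P3 : P * r3 = 0.
  transitivity (g1 * g2 * L * (L * r1 - g1 * r2)
    + g2 * L ^+ 2 * (L * r2 - g1 * r1 - g2 * r3)
    + L * (L ^+ 2 - g1 ^+ 2) * (L * r3 - g2 * r2 - g3 * r4)
    + g3 * (L ^+ 2 - g1 ^+ 2) * (L * r4 - g3 * r3)); first by rewrite EP; ring.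
  by rewrite E1 E2 E3 E4 !mulr0 !addr0.
have P4 : P * r4 = 0.
  transitivity (g1 * g2 * g3 * (L * r1 - g1 * r2)
    + L * g2 * g3 * (L * r2 - g1 * r1 - g2 * r3)
    + g3 * (L ^+ 2 - g1 ^+ 2) * (L * r3 - g2 * r2 - g3 * r4)
    + (L ^+ 3 - (g1 ^+ 2 + g2 ^+ 2) * L) * (L * r4 - g3 * r3));
    first by rewrite EP; ring.
  by rewrite E1 E2 E3 E4 !mulr0 !addr0.
transitivity (P * r1 * r1 + P * r2 * r2 + P * r3 * r3 + P * r4 * r4).
  by rewrite -[LHS]mulr1 -Hr; ring.
by rewrite P1 P2 P3 P4 !mul0r !addr0.
Qed.

Lemma cauchy2 (R : realType) (a b c d : R) :
  a * c + b * d <= Num.sqrt (a ^+ 2 + b ^+ 2) * Num.sqrt (c ^+ 2 + d ^+ 2).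
Proof.
have pos (u v : R) : 0 <= u ^+ 2 + v ^+ 2 by rewrite addr_ge0 ?sqr_ge0.
apply: (le_trans (ler_norm _)).
rewrite -ler_sqr ?nnegrE ?mulr_ge0 ?sqrtr_ge0 // real_normK ?num_real //.
rewrite exprMn !sqr_sqrtr // -subr_ge0.
have -> : (a ^+ 2 + b ^+ 2) * (c ^+ 2 + d ^+ 2) - (a * c + b * d) ^+ 2
  = (a * d - b * c) ^+ 2 by ring.
exact: sqr_ge0.
Qed.

(** For fixed moduli |x_j|, the best phases turn the linear form into a real tridiagonal quadratic
    form in the moduli with coefficients [g k l]. These phases are available by [nr4_phase], so [h]
    is the maximum of that form on the unit sphere. *)
Lemma nr4_support (R : realType) (k1 k2 k3 l1 l2 l3 al be h x0 y0 : R) :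
  (forall x y, nr4 k1 k2 k3 l1 l2 l3 x y -> al * x + be * y <= h) ->
  nr4 k1 k2 k3 l1 l2 l3 x0 y0 -> al * x0 + be * y0 = h ->
  let g2 k l := (al * k) ^+ 2 + (be * l) ^+ 2 in
  16 * h ^+ 4 - 4 * (g2 k1 l1 + g2 k2 l2 + g2 k3 l3) * h ^+ 2
    + g2 k1 l1 * g2 k3 l3 = 0.
Proof.
move=> Hmax [p1 [q1 [p2 [q2 [p3 [q3 [p4 [q4 [N Ex Ey]]]]]]]]] Eh g2.
have g2_ge0 k l : 0 <= g2 k l by rewrite addr_ge0 ?sqr_ge0.
pose g k l := Num.sqrt (g2 k l).
have gE k l : g2 k l = g k l ^+ 2 by rewrite sqr_sqrtr.
pose r (p q : R) := Num.sqrt (p ^+ 2 + q ^+ 2).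
have rE p q : r p q ^+ 2 = p ^+ 2 + q ^+ 2.
  by rewrite sqr_sqrtr // addr_ge0 ?sqr_ge0.
(* The unit vector (c, s) is aligned with (al k, be l). *)
have optimal_phase k l : exists c s : R,
    c ^+ 2 + s ^+ 2 = 1 /\ al * k * c + be * l * s = g k l.
  have [g0|g_neq0] := eqVneq (g k l) 0.
    exists 1, 0; split; first by rewrite expr1n expr0n addr0.
    have := gE k l; rewrite g0 expr0n /g2 => /eqP.
    by rewrite paddr_eq0 ?sqr_ge0 // !sqrf_eq0 => /andP[/eqP-> _]; rewrite mul0r mulr0 addr0.
  exists (al * k / g k l), (be * l / g k l); split.
    by rewrite !expr_div_n -mulrDl -/(g2 k l) gE divff // expf_neq0.
  rewrite mulrA -expr2 mulrA -expr2 -mulrDl -/(g2 k l) gE expr2 mulfK //.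
(* Cauchy-Schwarz, together with |x' conj(x)| = |x'| |x|. *)
have pair k l p q p' q' : al * (k * (p' * p + q' * q)) + be * (l * (q' * p - p' * q))
    <= g k l * (r p q * r p' q').
  have -> : r p q * r p' q' =
      Num.sqrt ((p' * p + q' * q) ^+ 2 + (q' * p - p' * q) ^+ 2).
    rewrite /r -sqrtrM ?addr_ge0 ?sqr_ge0 //; congr Num.sqrt; ring.
  by rewrite !mulrA; exact: cauchy2.
rewrite !gE.
apply: (tridiagonal_max_eigenvalue _ _ _ _ _ (r p1 q1) (r p2 q2) (r p3 q3) (r p4 q4)).
- move=> s1 s2 s3 s4.
  pose n := s1 ^+ 2 + s2 ^+ 2 + s3 ^+ 2 + s4 ^+ 2.
  have n_ge0 : 0 <= n by rewrite !addr_ge0 ?sqr_ge0.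
  have [n0|n_neq0] := eqVneq n 0.
    have z1 : s1 ^+ 2 = 0.
      by move: n0; rewrite /n; have := sqr_ge0 s1; have := sqr_ge0 s2;
        have := sqr_ge0 s3; have := sqr_ge0 s4; lra.
    have z2 : s2 ^+ 2 = 0.
      by move: n0; rewrite /n; have := sqr_ge0 s1; have := sqr_ge0 s2;
        have := sqr_ge0 s3; have := sqr_ge0 s4; lra.
    have z3 : s3 ^+ 2 = 0.
      by move: n0; rewrite /n; have := sqr_ge0 s1; have := sqr_ge0 s2;
        have := sqr_ge0 s3; have := sqr_ge0 s4; lra.
    rewrite -/n n0.
    move/eqP: z1; move/eqP: z2; move/eqP: z3; rewrite !sqrf_eq0.
    by move=> /eqP-> /eqP-> /eqP->; rewrite !(mul0r, mulr0, addr0).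
  have [c1 [t1 [N1 G1]]] := optimal_phase k1 l1.
  have [c2 [t2 [N2 G2]]] := optimal_phase k2 l2.
  have [c3 [t3 [N3 G3]]] := optimal_phase k3 l3.
  pose m := Num.sqrt n.
  have m2 : m ^+ 2 = n by rewrite sqr_sqrtr.
  have m0 : m != 0 by rewrite -sqrf_eq0 m2.
  have Hs : (s1 / m) ^+ 2 + (s2 / m) ^+ 2 + (s3 / m) ^+ 2 + (s4 / m) ^+ 2 = 1.
    by rewrite !expr_div_n -!mulrDl m2 divff.
  have := Hmax _ _ (nr4_phase _ k1 k2 k3 l1 l2 l3 _ _ _ _ _ _ _ _ _ _ N1 N2 N3 Hs).
  rewrite -/n -[h * n]mulrC -ler_pdivrMl ?lt_def ?n_neq0 //.
  congr (_ <= _); rewrite -m2 -G1 -G2 -G3; field; exact: m0.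
- by rewrite !rE -N; ring.
- rewrite -Eh Ex Ey !mulrDr.
  have := pair k1 l1 p1 q1 p2 q2; have := pair k2 l2 p2 q2 p3 q3.
  have := pair k3 l3 p3 q3 p4 q4; lra.
Qed.

(** * Necessity *)

Lemma poly_eq0_near (R : realType) (P : {poly R}) (t0 e : R) : 0 < e ->
  (forall t, `|t - t0| < e -> P.[t] = 0) -> P = 0.
Proof.
move=> e0 H.
(* With [n.+2] the distance to [t0] is strictly below [e] already at n = 0. *)
pose f (n : nat) : R := t0 + e / n.+2%:R.
apply: (roots_geq_poly_eq0 (rs := [seq f n | n <- iota 0 (size P)])).
- apply/allP => x /mapP[n _ ->]; apply/eqP/H.
  rewrite /f addrC addKr gtr0_norm ?divr_gt0 // ltr_pdivrMr //.
  by rewrite ltr_pMr // ltr1n.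
- rewrite map_inj_uniq ?iota_uniq // => m n /addrI/(mulfI (lt0r_neq0 e0))/invr_inj.
  by move/eqP; rewrite eqr_nat => /eqP[].
- by rewrite size_map size_iota.
Qed.

(** Descent on the size of [Y]: [Q] divides [X], then [Y], and the two quotients by [Q] satisfy the
    same equation. *)
Lemma irreducible_nonsquare (F : fieldType) (Q X Y : {poly F}) :
  irreducible_poly Q -> X ^+ 2 = Y ^+ 2 * Q -> Y = 0.
Proof.
move=> irrQ; have Q0 := irredp_neq0 irrQ.
have dvd_sq Z : Q %| Z ^+ 2 -> Q %| Z.
  rewrite expr2 => H; apply/negPn; rewrite -irreducible_poly_coprime //.
  apply/negP => coQZ; move: (H); rewrite Gauss_dvdpr // => QZ.
  by move: coQZ; rewrite irreducible_poly_coprime // QZ.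
have [n] := ubnP (size Y); elim: n X Y => // n IHn X Y szY E.
have [//|Y0] := eqVneq Y 0.
have /dvdpP[X1 EX] : Q %| X by apply: dvd_sq; rewrite E dvdp_mull.
have E1 : Y ^+ 2 = X1 ^+ 2 * Q.
  by apply: (mulIf Q0); rewrite -E EX; ring.
have /dvdpP[Y1 EY] : Q %| Y by apply: dvd_sq; rewrite E1 dvdp_mull.
have E2 : X1 ^+ 2 = Y1 ^+ 2 * Q.
  by apply: (mulIf Q0); rewrite -E1 EY; ring.
have Y1_0 : Y1 != 0 by apply: contra_neq Y0 => Y1_0; rewrite EY Y1_0 mul0r.
suff : Y1 = 0 by move=> Y1E; rewrite Y1E eqxx in Y1_0.
apply: IHn E2; move: szY; rewrite EY size_mul //.
have [szQ _] := irrQ; move: szQ; have := size_poly_gt0 Y1; rewrite Y1_0.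
case: (size Y1) => // a _; case: (size Q) => [|[|b]] // _.
by rewrite addnS /= ltnS; apply: leq_trans; rewrite addnS !ltnS leq_addr.
Qed.

(* If the conic [lam = u + sqrt Q] lies locally on the quartic
   [lam ^ 4 - S lam ^ 2 + D = 0], so does its conjugate [u - sqrt Q]; by evenness
   the quartic is then [((lam - u) ^ 2 - Q) ((lam + u) ^ 2 - Q)]. *)
Lemma biquadratic_conic (R : realType) (u Q S D : {poly R}) (t0 e : R) :
  irreducible_poly Q -> u != 0 -> (forall t, 0 <= Q.[t]) -> 0 < e ->
  (forall t, `|t - t0| < e -> let h := u.[t] + Num.sqrt Q.[t] in
     h ^+ 4 - S.[t] * h ^+ 2 + D.[t] = 0) ->
  S = 2 * (u ^+ 2 + Q) /\ D = (u ^+ 2 - Q) ^+ 2.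
Proof.
move=> irrQ u0 Q_ge0 e0 H.
(* Substituting lam = u + s with s^2 = Q turns the quartic into X + Y s. Where it vanishes, X^2 =
   Y^2 Q, and this extends from a neighborhood of [t0] to all polynomials values. *)
pose X := (u ^+ 2 + Q) ^+ 2 + 4 * u ^+ 2 * Q - S * (u ^+ 2 + Q) + D.
pose Y := 2 * u * (2 * (u ^+ 2 + Q) - S).
have XY : X ^+ 2 = Y ^+ 2 * Q.
  apply/eqP; rewrite -subr_eq0; apply/eqP; apply: (poly_eq0_near _ _ t0 e e0).
  move=> t /H /=; set s := Num.sqrt _.
  have s2 : s ^+ 2 = Q.[t] by rewrite sqr_sqrtr.
  have hs : X.[t] + Y.[t] * s = (u.[t] + s) ^+ 4 - S.[t] * (u.[t] + s) ^+ 2 + D.[t].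
    by rewrite /X /Y !hornerE /= -s2; ring.
  move=> h0; have {h0}hs : X.[t] = - (Y.[t] * s).
    by apply/eqP; rewrite -addr_eq0 hs h0.
  by rewrite hornerD hornerN !horner_exp hornerM horner_exp hs -s2; ring.
have Y0 := irreducible_nonsquare _ _ _ _ irrQ XY.
have X0 : X = 0.
  by apply/eqP; rewrite -sqrf_eq0 XY Y0 expr0n mul0r.
have ES : S = 2 * (u ^+ 2 + Q).
  move/eqP: Y0; rewrite /Y !mulf_eq0 (negPf u0) orbF.
  have -> : (2 : {poly R}) == 0 = false by rewrite -polyC_natr polyC_eq0 pnatr_eq0.
  by rewrite /= subr_eq0 => /eqP.
split=> //.
have -> : D = X - ((u ^+ 2 + Q) ^+ 2 + 4 * u ^+ 2 * Q - S * (u ^+ 2 + Q)).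
  by rewrite /X; ring.
by rewrite X0 ES; ring.
Qed.

Lemma quadratic_pos_near (R : realType) (a b c t0 : R) :
  0 < a + b * t0 + c * t0 ^+ 2 ->
  exists2 e, 0 < e & forall t, `|t - t0| < e -> 0 < a + b * t + c * t ^+ 2.
Proof.
set v := _ + _ => v0.
(* [B] is the derivative at [t0]; [K] bounds |B + c d| for |d| < 1, and its summand 1 makes it
   positive. *)
pose B := b + 2 * c * t0.
pose K := `|B| + `|c| + 1.
have K0 : 0 < K by rewrite /K ltr_wpDl ?addr_ge0.
exists (Num.min 1 (v / K)); first by rewrite lt_min ltr01 divr_gt0.
move=> t; set d := t - t0; rewrite lt_min => /andP[d1 dK].
have -> : a + b * t + c * t ^+ 2 = v + (B + c * d) * d.
  by rewrite /v /B /d; ring.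
have : `|(B + c * d) * d| < v.
  rewrite normrM; apply: (@le_lt_trans _ _ (K * `|d|)).
    rewrite ler_wpM2r // (le_trans (ler_normD _ _)) // /K -addrA lerD2l.
    rewrite normrM; apply: (@le_trans _ _ `|c|); last by rewrite lerDl.
    by rewrite ler_piMr // ltW.
  by rewrite mulrC -ltr_pdivlMr.
rewrite ltr_norml => /andP[]; lra.
Qed.

(** A point of [E1] outside the hull of [E2] is strictly separated from [E2]. This persists for
    nearby directions, in which the support function of the whole hull is therefore that of [E1].
    Fixing [al] leaves one parameter [t], so that polynomials in one variable suffice. *)
Lemma exposed_ellipse (R : realType) (c1 c2 u1 u2 p q d1 d2 v1 v2 p' q' : R) :
  u1 ^+ 2 + u2 ^+ 2 = 1 -> 0 < p -> 0 < q ->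
  v1 ^+ 2 + v2 ^+ 2 = 1 -> 0 < p' -> 0 < q' ->
  let E1 := ellipse (c1 +i* c2) (u1 +i* u2) p q in
  let E2 := ellipse (d1 +i* d2) (v1 +i* v2) p' q' in
  ~ (E1 `<=` convex_hull E2)%classic ->
  exists al t0 e : R, [/\ al != 0, 0 < e & forall t, `|t - t0| < e ->
    let h := al * c1 + t * c2 + Num.sqrt (width2 u1 u2 p q al t) in
    (forall x y, convex_hull (E1 `|` E2)%classic (x +i* y) -> al * x + t * y <= h) /\
    (exists x y : R, convex_hull (E1 `|` E2)%classic (x +i* y) /\ al * x + t * y = h)].
Proof.
move=> u_unit p0 q0 v_unit p'0 q'0 E1 E2 NE12.
have [x [y [Ez Nz]]] : exists x y : R, E1 (x +i* y) /\ ~ convex_hull E2 (x +i* y).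
  move/existsNP: NE12 => [[x y]] /not_implyP[Ez Nz]; by exists x, y.
have [al0 [be0 [L0 Q0]]] := ellipse_separation _ _ _ _ _ _ _ v_unit p'0 q'0 _ _ Nz.
set X := x - d1 in L0 Q0; set Y := y - d2 in L0 Q0.
(* The squared support value of z minus that of E2, as a binary quadratic form. *)
pose F al be := (al * X + be * Y) ^+ 2 - width2 v1 v2 p' q' al be.
pose fA := X ^+ 2 - p' ^+ 2 * v1 ^+ 2 - q' ^+ 2 * v2 ^+ 2.
pose fB := 2 * (X * Y - p' ^+ 2 * v1 * v2 + q' ^+ 2 * v1 * v2).
pose fC := Y ^+ 2 - p' ^+ 2 * v2 ^+ 2 - q' ^+ 2 * v1 ^+ 2.
have FE al be : F al be = fA * al ^+ 2 + fB * al * be + fC * be ^+ 2.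
  by rewrite /F /width2 /fA /fB /fC; ring.
have [al [al_neq0 L1 F1]] : exists al : R, [/\ al != 0, 0 < al * X + be0 * Y & 0 < F al be0].
  (* If [al0] is 0, it is moved to a small positive value; both strict inequalities are open
     conditions. *)
  have [al0_0|] := eqVneq al0 0; last first.
    by move=> al0_neq0; exists al0; rewrite /F subr_gt0.
  have [|e1 e1_gt0 H1] := quadratic_pos_near _ (be0 * Y) X 0 al0.
    by rewrite mul0r addr0 addrC mulrC.
  have [|e2 e2_gt0 H2] := quadratic_pos_near _ (fC * be0 ^+ 2) (fB * be0) fA al0.
    have := Q0; rewrite -subr_gt0 -/(F al0 be0) FE; congr (0 < _); ring.
  pose e := Num.min e1 e2 / 2.
  have m0 : 0 < Num.min e1 e2 by rewrite lt_min e1_gt0.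
  have e0 : 0 < e by rewrite /e divr_gt0.
  have : e < Num.min e1 e2 by rewrite /e; lra.
  rewrite lt_min => /andP[ee1 ee2].
  exists e; split; first by rewrite gt_eqF.
    have := H1 e; rewrite al0_0 subr0 gtr0_norm // => /(_ ee1); congr (0 < _); ring.
  have := H2 e; rewrite al0_0 subr0 gtr0_norm // => /(_ ee2); rewrite FE; congr (0 < _); ring.
have [|e1 e1_gt0 H1] := quadratic_pos_near _ (al * X) Y 0 be0.
  by rewrite mul0r addr0 [Y * _]mulrC.
have [|e2 e2_gt0 H2] := quadratic_pos_near _ (fA * al ^+ 2) (fB * al) fC be0.
  by have := F1; rewrite FE; congr (0 < _); ring.
exists al, be0, (Num.min e1 e2); split=> //; first by rewrite lt_min e1_gt0.
move=> t; rewrite lt_min => /andP[te1 te2] h.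
have Lt : 0 < al * X + t * Y by have := H1 t te1; congr (0 < _); ring.
have Ft : 0 < F al t by have := H2 t te2; rewrite FE; congr (0 < _); ring.
have le1 x' y' : E1 (x' +i* y') -> al * x' + t * y' <= h.
  move=> /(ellipse_width_le _ _ _ _ _ _ _ p0 q0 _ _ al t); rewrite /h; lra.
have le2 x' y' : E2 (x' +i* y') -> al * x' + t * y' <= h.
  move=> /(ellipse_width_le _ _ _ _ _ _ _ p'0 q'0 _ _ al t) H.
  have : Num.sqrt (width2 v1 v2 p' q' al t) <= al * X + t * Y.
    rewrite -[leRHS]gtr0_norm // -sqrtr_sqr ler_wsqrtr // -subr_ge0 ltW //.
  have := le1 _ _ Ez; rewrite /X /Y; lra.
split.
  apply: convex_hull_min => [a b a' b' s /andP[s0 s1] H H'|a b [|]]; [|exact: le1|exact: le2].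
  have -> : al * (s * a + (1 - s) * a') + t * (s * b + (1 - s) * b')
    = s * (al * a + t * b) + (1 - s) * (al * a' + t * b') by ring.
  have -> : h = s * h + (1 - s) * h by ring.
  by rewrite lerD // ler_wpM2l // subr_ge0.
have [a [b [Eab Hab]]] :=
  ellipse_width_attained _ c1 c2 _ _ _ _ u_unit p0 q0 al t al_neq0.
exists a, b; split; first by apply: sub_convex_hull; left.
rewrite /h -Hab; ring.
Qed.

(** The forms of the two identities for u^2 + Q and (u^2 - Q)^2 in direction (al, t), where [al],
    [ka_j], [la_j] stand for the squares of al, k_j, l_j. The coefficients [e0], [e1], [e2] are
    those of u^2 - Q. *)
Lemma biquadratic_coef (R : realType)
    (al ka1 ka2 ka3 la1 la2 la3 U0 U1 q0 q1 q2 : R) :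
  0 < al -> ka1 = la1 + 4 -> ka2 = la2 + 4 -> ka3 = la3 + 4 ->
  0 <= la1 -> 0 <= la2 -> 0 <= la3 -> 0 < q2 ->
  (forall t, (al * ka1 + t ^+ 2 * la1) + (al * ka2 + t ^+ 2 * la2)
     + (al * ka3 + t ^+ 2 * la3)
   = 8 * ((U0 + U1 * t) ^+ 2 + (q0 + q1 * t + q2 * t ^+ 2))) ->
  (forall t, (al * ka1 + t ^+ 2 * la1) * (al * ka3 + t ^+ 2 * la3)
   = 16 * ((U0 + U1 * t) ^+ 2 - (q0 + q1 * t + q2 * t ^+ 2)) ^+ 2) ->
  [/\ la1 = la3, 0 < la1 & la2 = 0].
Proof.
move=> al0 K1 K2 K3 l1 l2 l3 q2_gt0 HS HD.
pose e0 := U0 ^+ 2 - q0; pose e1 := 2 * U0 * U1 - q1; pose e2 := U1 ^+ 2 - q2.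
have HD' t : (al * ka1 + t ^+ 2 * la1) * (al * ka3 + t ^+ 2 * la3)
   = 16 * (e0 + e1 * t + e2 * t ^+ 2) ^+ 2.
  by rewrite HD /e0 /e1 /e2; congr (_ * _ ^+ 2); ring.
have HS' t : (al * ka1 + t ^+ 2 * la1) + (al * ka2 + t ^+ 2 * la2)
     + (al * ka3 + t ^+ 2 * la3)
   = 16 * (U0 + U1 * t) ^+ 2 - 8 * (e0 + e1 * t + e2 * t ^+ 2).
  by rewrite HS /e0 /e1 /e2; ring.
(* Five values determine the coefficients of a quartic. *)
have D0 := HD' 0; have D1 := HD' 1; have D2 := HD' (-1); have D3 := HD' 2.
have D4 := HD' (-2).
have S0 := HS' 0; have S1 := HS' 1; have S2 := HS' (-1).
have C0 : 16 * e0 ^+ 2 = al ^+ 2 * ka1 * ka3 by lra.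
have C1 : e0 * e1 = 0 by lra.
have C2 : 16 * (2 * e0 * e2 + e1 ^+ 2) = al * (ka1 * la3 + ka3 * la1) by lra.
have C4 : 16 * e2 ^+ 2 = la1 * la3 by lra.
have B0 : al * (ka1 + ka2 + ka3) = 16 * U0 ^+ 2 - 8 * e0 by lra.
have B1 : 4 * U0 * U1 = e1 by lra.
have B2 : la1 + la2 + la3 = 16 * U1 ^+ 2 - 8 * e2 by lra.
have ka1_gt0 : 0 < ka1 by lra.
have ka2_gt0 : 0 < ka2 by lra.
have ka3_gt0 : 0 < ka3 by lra.
have e0_neq0 : e0 != 0.
  rewrite -sqrf_eq0; apply/eqP => E; move/eqP: C0; rewrite E mulr0 eq_sym.
  by rewrite !mulf_eq0 ?expf_eq0 /= !gt_eqF.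
have e1_0 : e1 = 0.
  by apply/eqP; move/eqP: C1; rewrite mulf_eq0 (negPf e0_neq0).
rewrite e1_0 expr0n addr0 in C2.
(* As a quadratic in t^2, the product is a square, so its discriminant vanishes. *)
have K13 : ka1 * la3 = ka3 * la1.
  apply/eqP; rewrite -subr_eq0 -sqrf_eq0; apply/eqP/(mulfI (expf_neq0 2 (lt0r_neq0 al0))).
  transitivity ((al * (ka1 * la3 + ka3 * la1)) ^+ 2
    - 4 * (al ^+ 2 * ka1 * ka3) * (la1 * la3)); first by ring.
  by rewrite -C2 -C0 -C4; ring.
have la13 : la1 = la3 by move: K13; rewrite K1 K3; lra.
have ka13 : ka1 = ka3 by rewrite K1 K3 la13.
rewrite -ka13 -la13 in C0 C2 C4 B0 B2 l3.
have C0' : (4 * e0 - al * ka1) * (4 * e0 + al * ka1) = 0.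
  have -> : (4 * e0 - al * ka1) * (4 * e0 + al * ka1) = 16 * e0 ^+ 2 - al ^+ 2 * ka1 * ka1 by ring.
  by rewrite C0 subrr.
have aka : al * ka1 != 0 by rewrite mulf_neq0 // gt_eqF.
have alka1 : 0 < al * ka1 by rewrite mulr_gt0.
have alka2 : 0 < al * ka2 by rewrite mulr_gt0.
have U1_0 : U0 ^+ 2 != 0 -> U1 = 0.
  rewrite sqrf_eq0 => U0_neq0; apply/eqP; move/eqP: B1.
  by rewrite e1_0 !mulf_eq0 (negPf U0_neq0) pnatr_eq0.
have Eq2 : q2 = U1 ^+ 2 - e2 by rewrite /e2 subKr.
move/eqP: C0'; rewrite mulf_eq0 subr_eq0 addr_eq0 => /orP[]/eqP E0.
(* Here [q2] would be - la1 / 4, against [0 < q2]. *)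
- have U1z : U1 = 0.
    apply: U1_0; rewrite gt_eqF //; lra.
  have e2E : 4 * e2 = la1.
    apply: (mulfI aka); rewrite -E0; transitivity (16 * (2 * e0 * e2) / 2); first by field.
    by rewrite C2 E0; field.
  move: B2 Eq2; rewrite U1z expr0n mulr0 !sub0r; lra.
(* Here q2 = la1 / 4, whence [0 < la1], and the t^2 coefficients of the sum leave la2 = 0. *)
- have U1z : U1 = 0.
    apply: U1_0; rewrite gt_eqF //; lra.
  have e2E : 4 * e2 = - la1.
    apply: (mulfI aka); rewrite -[al * ka1]opprK -E0.
    transitivity (- (16 * (2 * e0 * e2) / 2)); first by field.
    by rewrite C2 E0; field.
  move: B2 Eq2; rewrite U1z expr0n mulr0 !sub0r => B2 Eq2; split; lra.
Qed.

Lemma bi_elliptical_necessary (R : realType) (W : set R[i])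
    (k1 k2 k3 l1 l2 l3 : R) :
  k1 ^+ 2 = l1 ^+ 2 + 4 -> k2 ^+ 2 = l2 ^+ 2 + 4 -> k3 ^+ 2 = l3 ^+ 2 + 4 ->
  (forall x y, W (x +i* y) <-> nr4 k1 k2 k3 l1 l2 l3 x y) ->
  bi_elliptical W -> [/\ l1 ^+ 2 = l3 ^+ 2, 0 < l1 ^+ 2 & l2 ^+ 2 = 0].
Proof.
move=> K1 K2 K3 HW [E1 [E2 [c [d [[]]]]]].
have unit (u1 u2 : R) : `|u1 +i* u2| = 1 -> u1 ^+ 2 + u2 ^+ 2 = 1.
  move=> H; have := normc_def; move/(_ _ (u1 +i* u2)); rewrite H /= => -[] /esym E.
  by rewrite -[LHS]sqr_sqrtr ?addr_ge0 ?sqr_ge0 // E expr1n.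
(* [F1] is whichever of the two ellipses has a nonzero center; one does, as the centers are
   distinct. *)
have main (c1 c2 u1 u2 p q d1 d2 v1 v2 p' q' : R) :
    u1 ^+ 2 + u2 ^+ 2 = 1 -> 0 < p -> 0 < q ->
    v1 ^+ 2 + v2 ^+ 2 = 1 -> 0 < p' -> 0 < q' ->
    let F1 := ellipse (c1 +i* c2) (u1 +i* u2) p q in
    let F2 := ellipse (d1 +i* d2) (v1 +i* v2) p' q' in
    (c1 != 0) || (c2 != 0) ->
    ~ (F1 `<=` convex_hull F2)%classic -> W = convex_hull (F1 `|` F2)%classic ->
    [/\ l1 ^+ 2 = l3 ^+ 2, 0 < l1 ^+ 2 & l2 ^+ 2 = 0].
  move=> u_unit p0 q0 v_unit p'0 q'0 F1 F2 c_neq0 NF WE.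
  have [al [t0 [e [al0 e0 H]]]] :=
    exposed_ellipse _ _ _ _ _ _ _ _ _ _ _ _ _ u_unit p0 q0 v_unit p'0 q'0 NF.
  pose qs := [:: al ^+ 2 * (p ^+ 2 * u1 ^+ 2 + q ^+ 2 * u2 ^+ 2);
    2 * al * (p ^+ 2 - q ^+ 2) * u1 * u2; p ^+ 2 * u2 ^+ 2 + q ^+ 2 * u1 ^+ 2].
  pose Q := Poly qs; pose u := Poly [:: al * c1; c2].
  pose S := Poly [:: al ^+ 2 * (k1 ^+ 2 + k2 ^+ 2 + k3 ^+ 2) / 4; 0;
                     (l1 ^+ 2 + l2 ^+ 2 + l3 ^+ 2) / 4].
  pose D := Poly [:: al ^+ 4 * k1 ^+ 2 * k3 ^+ 2 / 16; 0;
    al ^+ 2 * (k1 ^+ 2 * l3 ^+ 2 + k3 ^+ 2 * l1 ^+ 2) / 16; 0;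
    l1 ^+ 2 * l3 ^+ 2 / 16].
  have QE t : Q.[t] = width2 u1 u2 p q al t.
    by rewrite horner_Poly /= /width2; ring.
  have uE t : u.[t] = al * c1 + t * c2 by rewrite horner_Poly /=; ring.
  have SE t : S.[t] = (al ^+ 2 * (k1 ^+ 2 + k2 ^+ 2 + k3 ^+ 2)
      + t ^+ 2 * (l1 ^+ 2 + l2 ^+ 2 + l3 ^+ 2)) / 4.
    by rewrite horner_Poly /=; field.
  have DE t : D.[t] = (al ^+ 2 * k1 ^+ 2 + t ^+ 2 * l1 ^+ 2)
      * (al ^+ 2 * k3 ^+ 2 + t ^+ 2 * l3 ^+ 2) / 16.
    by rewrite horner_Poly /=; field.
  have Q_gt0 t : 0 < Q.[t] by rewrite QE width2_gt0.
  have q2_gt0 : 0 < p ^+ 2 * u2 ^+ 2 + q ^+ 2 * u1 ^+ 2.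
    (* Direction (0, 1) has first coordinate 0, so the ellipse is rotated by a quarter turn and
       direction (1, 0) is used. *)
    have := width2_gt0 R u2 (- u1) p q; rewrite sqrrN addrC => /(_ u_unit p0 q0 1 0 (oner_neq0 _)).
    rewrite /width2; congr (0 < _); ring.
  have irrQ : irreducible_poly Q.
    apply: cubic_irreducible.
      by rewrite /Q (PolyK (c := 0)) //= gt_eqF.
    by move=> x; rewrite /root gt_eqF.
  have u_neq0 : u != 0.
    apply/eqP => u_0; move: c_neq0; apply/negP; rewrite negb_or !negbK.
    have := uE 0; have := uE 1; rewrite u_0 !horner0 mul1r mul0r addr0.
    move=> Hu1 /esym/eqP Hu0; rewrite mulf_eq0 (negPf al0) /= in Hu0.
    by rewrite Hu0; apply/eqP; rewrite Hu1 (eqP Hu0) mulr0 add0r.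
  have [||ES ED] := biquadratic_conic _ u Q S D t0 e irrQ u_neq0 _ e0.
  - by move=> t; rewrite ltW.
  - move=> t /H; rewrite uE QE -WE /= => -[Hmax [x [y [Wxy Hxy]]]].
    have Hmax' x' y' : nr4 k1 k2 k3 l1 l2 l3 x' y' -> al * x' + t * y' <=
        al * c1 + t * c2 + Num.sqrt (width2 u1 u2 p q al t).
      by move/HW; exact: Hmax.
    have /HW Nxy := Wxy.
    have := nr4_support _ _ _ _ _ _ _ _ _ _ _ _ Hmax' Nxy Hxy.
    set h := _ + Num.sqrt _ => /= E.
    apply: (mulfI (_ : 16 != 0 :> R)); first by rewrite pnatr_eq0.
    by rewrite mulr0 -[RHS]E SE DE; field.
  apply: (biquadratic_coef _ (al ^+ 2) (k1 ^+ 2) (k2 ^+ 2) (k3 ^+ 2) (l1 ^+ 2) (l2 ^+ 2) (l3 ^+ 2)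
    (al * c1) c2 (qs`_0) (qs`_1) (qs`_2)).
  all: try exact: sqr_ge0.
  all: try done.
  - by rewrite exprn_even_gt0.
  - move=> t; have := congr1 (fun P => 4 * P.[t]) ES; rewrite SE.
    rewrite -polyC_natr !(hornerM, hornerD, horner_exp, hornerC, uE, QE) /width2 => E.
    transitivity (4 * ((al ^+ 2 * (k1 ^+ 2 + k2 ^+ 2 + k3 ^+ 2)
      + t ^+ 2 * (l1 ^+ 2 + l2 ^+ 2 + l3 ^+ 2)) / 4)); first by field.
    by rewrite E /=; ring.
  - move=> t; have := congr1 (fun P => 16 * P.[t]) ED; rewrite DE.
    rewrite !(horner_exp, hornerD, hornerN, uE, QE) /width2 => E.
    transitivity (16 * ((al ^+ 2 * k1 ^+ 2 + t ^+ 2 * l1 ^+ 2)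
      * (al ^+ 2 * k3 ^+ 2 + t ^+ 2 * l3 ^+ 2) / 16)); first by field.
    by rewrite E /=; ring.
move=> [u [p [q [Nu p0 q0 ->]]]] [v [p' [q' [Nv p'0 q'0 ->]]]].
case: c u d v Nu Nv => [c1 c2] [u1 u2] [d1 d2] [v1 v2] Nu Nv cd [N1 N2 WE].
have u_unit := unit _ _ Nu; have v_unit := unit _ _ Nv.
have [c_neq0|] := boolP ((c1 != 0) || (c2 != 0)).
  exact: (main c1 c2 u1 u2 p q d1 d2 v1 v2 p' q').
rewrite negb_or !negbK => /andP[/eqP c1_0 /eqP c2_0].
apply: (main d1 d2 v1 v2 p' q' c1 c2 u1 u2 p q) => //; last by rewrite setUC.
rewrite -negb_and; apply/negP => /andP[/eqP d1_0 /eqP d2_0].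
by apply: cd; rewrite c1_0 c2_0 d1_0 d2_0.
Qed.

(** * Sufficiency *)

(* Replacing the phase of x_1 conjugates x_2 conj(x_1) and changes nothing else. *)
Lemma nr4_flip (R : realType) (k1 k2 k3 l1 l2 l3 x y : R) :
  nr4 k1 k2 k3 l1 l2 l3 x y -> nr4 k1 k2 k3 (- l1) l2 l3 x y.
Proof.
case=> p1 [q1 [p2 [q2 [p3 [q3 [p4 [q4 [N -> ->]]]]]]]].
have [n0|n_neq0] := eqVneq (p2 ^+ 2 + q2 ^+ 2) 0.
  exists p1, q1, p2, q2, p3, q3, p4, q4; split=> //.
  move/eqP: n0; rewrite paddr_eq0 ?sqr_ge0 // !sqrf_eq0 => /andP[/eqP-> /eqP->].
  by ring.
set n := _ + _ in n_neq0.
(* The new x_1 is x_2^2 conj(x_1) / |x_2|^2, of the same modulus as x_1. *)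
exists (((p2 ^+ 2 - q2 ^+ 2) * p1 + 2 * p2 * q2 * q1) / n),
  ((2 * p2 * q2 * p1 - (p2 ^+ 2 - q2 ^+ 2) * q1) / n), p2, q2, p3, q3, p4, q4.
split.
- by rewrite -[RHS]N /n; field.
- by rewrite /n; field.
- by rewrite /n; field.
Qed.

(* The Minkowski sum of the segment [-1/2, 1/2] and of the disk of an ellipse. *)
Definition stadium {R : realType} (p q x y : R) : Prop :=
  exists2 v, -1 / 2 <= v <= 1 / 2 & ((x - v) / p) ^+ 2 + (y / q) ^+ 2 <= 1.

Lemma convex_hull_mono (R : realType) (S T : set R[i]) :
  (S `<=` T)%classic -> (convex_hull S `<=` convex_hull T)%classic.
Proof. by move=> ST z Hz B [cB TB]; apply: Hz; split=> // w /ST/TB. Qed.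

Lemma stadium_bi_elliptical (R : realType) (p q : R) (W : set R[i]) :
  0 < p -> 0 < q -> (forall x y, W (x +i* y) <-> stadium p q x y) ->
  bi_elliptical W.
Proof.
move=> p0 q0 HW.
have p_neq0 := lt0r_neq0 p0.
have one_unit : (1 : R) ^+ 2 + 0 ^+ 2 = 1 by rewrite expr1n expr0n addr0.
pose E (c : R) := ellipse (c +i* 0) (1 +i* 0) p q.
have EE c x y : E c (x +i* y) <-> ((x - c) / p) ^+ 2 + (y / q) ^+ 2 = 1.
  split=> [/ellipseE[w1 [w2 [Hw -> ->]]]|H].
    rewrite -[RHS]Hw; congr ((_ / _) ^+ 2 + (_ / _) ^+ 2); ring.
  by apply/ellipseE; exists (x - c), y; split=> //; ring.
have E_center c : ellipse_with_center (c +i* 0) (E c).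
  exists (1 +i* 0), p, q; split=> //.
  by rewrite normc_def /= one_unit sqrtr1.
(* The vertex of [E c] on the side away from [d] exceeds the support value of [E d] in that
   direction. *)
have E_far c d : c != d -> ~ (E c `<=` convex_hull (E d))%classic.
  move=> cd Hsub.
  pose s : R := Num.sg (c - d).
  have s2 : s ^+ 2 = 1 by rewrite sqr_sg subr_eq0 cd.
  have : E c ((c + s * p) +i* 0).
    apply/EE; rewrite [c + _]addrC addrK mulfK // s2 mul0r expr0n addr0 //.
  move/Hsub/(hull_width_le _ _ _ _ _ _ _ p0 q0 _ _ s 0).
  have -> : width2 1 0 p q s 0 = p ^+ 2 * s ^+ 2 by rewrite /width2; ring.
  rewrite s2 mulr1 sqrtr_sqr (gtr0_norm p0) mul0r addr0.
  have -> : s * (c + s * p - d) = s * (c - d) + s ^+ 2 * p by ring.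
  rewrite s2 mul1r; have : 0 < s * (c - d).
    by rewrite /s -normrEsg normr_gt0 subr_eq0.
  lra.
exists (E (1 / 2)), (E (-1 / 2)), ((1 / 2) +i* 0), ((-1 / 2) +i* 0).
split; split => //.
- by move=> [] H; have : (1 : R) / 2 <> - 1 / 2 by lra.
- by apply: E_far; apply/eqP; lra.
- by apply: E_far; apply/eqP; lra.
apply/seteqP; split=> -[x y].
- move/HW => [v /andP[v1 v2] Hv].
  pose t := v + 1 / 2.
  have t01 : 0 <= t <= 1 by rewrite /t; apply/andP; split; lra.
  have inE c : convex_hull (E c) ((c + (x - v)) +i* y).
    have := disk_sub_hull _ c 0 1 0 p q p0 (x - v) y Hv.
    by congr (convex_hull _ (_ +i* _)); ring.
  have := convex_hull_conv _ _ _ _ _ _ _ t01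
    (convex_hull_mono _ _ _ (@subsetUl _ _ _) _ (inE (1 / 2)))
    (convex_hull_mono _ _ _ (@subsetUr _ _ _) _ (inE (-1 / 2))).
  by congr (convex_hull _ (_ +i* _)); rewrite /t; field.
- move=> H; apply/HW; move: x y H.
  apply: convex_hull_min => [x y x' y' t /andP[t0 t1]|x y [] /EE H]; last 2 first.
  + by exists (1 / 2); [apply/andP; split; lra|rewrite H].
  + by exists (-1 / 2); [apply/andP; split; lra|rewrite H].
  move=> [v /andP[v1 v2] Hv] [v' /andP[v1' v2'] Hv'].
  have t1' : 0 <= 1 - t by rewrite subr_ge0.
  exists (t * v + (1 - t) * v').
    by have := mulr_ge0 t0 (_ : 0 <= v + 1 / 2); nra.
  move: Hv Hv'; set a := (x - v) / p; set b := y / q.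
  set a' := (x' - v') / p; set b' := y' / q => Hv Hv'.
  have -> : (t * x + (1 - t) * x' - (t * v + (1 - t) * v')) / p = t * a + (1 - t) * a'.
    by rewrite /a /a'; field.
  have -> : (t * y + (1 - t) * y') / q = t * b + (1 - t) * b'.
    by rewrite /b /b'; field; rewrite gt_eqF.
  have -> : (t * a + (1 - t) * a') ^+ 2 + (t * b + (1 - t) * b') ^+ 2
    = t * (a ^+ 2 + b ^+ 2) + (1 - t) * (a' ^+ 2 + b' ^+ 2)
      - t * (1 - t) * ((a - a') ^+ 2 + (b - b') ^+ 2) by ring.
  have := mulr_ge0 (mulr_ge0 t0 t1') (addr_ge0 (sqr_ge0 (a - a')) (sqr_ge0 (b - b'))).
  have := ler_wpM2l t0 Hv; have := ler_wpM2l t1' Hv'; lra.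
Qed.

(** One half of the elliptical range theorem, for a 2 by 2 block with diagonal -1/2, 1/2 and unit
    vector (y1, e + i f). Such vectors cover the sphere of radius 1/2 with coordinates de = e^2 +
    f^2 - 1/2, w1 = y1 e, w2 = y1 f, of which the elliptical disk is a linear image. *)
Lemma disk_spinor (R : realType) (k l X Y : R) : l != 0 ->
  4 * (X ^+ 2 / (1 + k ^+ 2) + Y ^+ 2 / l ^+ 2) <= 1 ->
  exists y1 e f : R, [/\ y1 ^+ 2 + e ^+ 2 + f ^+ 2 = 1,
    X = e ^+ 2 + f ^+ 2 - 1 / 2 + k * (y1 * e) & Y = l * (y1 * f)].
Proof.
move=> l0 H.
have k0 : 1 + k ^+ 2 != 0 by rewrite gt_eqF // ltr_pwDl ?ltr01 ?sqr_ge0.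
have k_gt0 : 0 < 1 + k ^+ 2 by rewrite ltr_pwDl ?ltr01 ?sqr_ge0.
(* A point (de, w1, w2) of the sphere of radius 1/2 with de + k w1 = X and
   l w2 = Y. *)
pose w2 := Y / l.
(* The solutions of de + k w1 = X are X / (1 + k^2) (1, k) + t (-k, 1); the sphere then requires t^2
   = m. *)
pose m := (1 / 4 - w2 ^+ 2 - X ^+ 2 / (1 + k ^+ 2)) / (1 + k ^+ 2).
have m_ge0 : 0 <= m.
  rewrite /m divr_ge0 // ?(ltW k_gt0) // /w2 expr_div_n; move: H; lra.
pose t := Num.sqrt m; have t2 : t ^+ 2 = m by rewrite sqr_sqrtr.
pose de := X / (1 + k ^+ 2) - k * t.
pose w1 := k * X / (1 + k ^+ 2) + t.
have Ew2 : Y = l * w2 by rewrite /w2 mulrC divfK.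
have EX : X = de + k * w1 by rewrite /de /w1; field.
have Es : de ^+ 2 + w1 ^+ 2 + w2 ^+ 2 = 1 / 4.
  have -> : de ^+ 2 + w1 ^+ 2 = X ^+ 2 / (1 + k ^+ 2) + (1 + k ^+ 2) * t ^+ 2.
    by rewrite /de /w1; field.
  by rewrite t2 /m; field.
rewrite EX Ew2; have [de2|de_neq] := eqVneq (1 / 2 - de) 0.
  have Ede : de = 1 / 2 by lra.
  have [w1_0 w2_0] : w1 = 0 /\ w2 = 0.
    have /eqP : w1 ^+ 2 + w2 ^+ 2 = 0 by rewrite Ede in Es; lra.
    by rewrite paddr_eq0 ?sqr_ge0 // !sqrf_eq0 => /andP[/eqP-> /eqP->].
  by exists 0, 1, 0; rewrite w1_0 w2_0 Ede; split; field.
have de_gt0 : 0 < 1 / 2 - de.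
  rewrite lt_def de_neq /=; have := sqr_ge0 w1; have := sqr_ge0 w2; nra.
pose z := Num.sqrt (1 / 2 - de).
have z2 : z ^+ 2 = 1 / 2 - de by rewrite sqr_sqrtr // ltW.
have z0 : z != 0 by rewrite gt_eqF // sqrtr_gt0.
have Hw : (w1 / z) ^+ 2 + (w2 / z) ^+ 2 = 1 / 2 + de.
  rewrite expr_div_n [X in _ + X]expr_div_n -mulrDl z2; apply: (canLR (mulfK de_neq)).
  by transitivity (1 / 4 - de ^+ 2); [rewrite -Es; ring|field].
exists z, (w1 / z), (w2 / z).
rewrite -addrA Hw z2 ![z * _]mulrC !divfK //; split; by field.
Qed.

(** Reversing the order of the coordinates is a symmetry, so a vector splits into a symmetric and an
    antisymmetric part, one for each 2 by 2 block. The shift [v] is half the difference of their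
    squared norms. *)
Lemma nr4_stadium (R : realType) (k l x y : R) : l != 0 ->
  nr4 k 2 k l 0 (- l) x y <->
  stadium (Num.sqrt (1 + k ^+ 2) / 2) (`|l| / 2) x y.
Proof.
move=> l0.
have k_gt0 : 0 < 1 + k ^+ 2 by rewrite ltr_pwDl ?ltr01 ?sqr_ge0.
have k0 := lt0r_neq0 k_gt0.
have dE X Y : (X / (Num.sqrt (1 + k ^+ 2) / 2)) ^+ 2 + (Y / (`|l| / 2)) ^+ 2
    = 4 * (X ^+ 2 / (1 + k ^+ 2) + Y ^+ 2 / l ^+ 2).
  rewrite !expr_div_n real_normK ?num_real // sqr_sqrtr ?ltW //; field.
  by rewrite l0 k0.
split.
- case=> p1 [q1 [p2 [q2 [p3 [q3 [p4 [q4 [N -> ->]]]]]]]].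
  pose v14 := p1 * p4 + q1 * q4; pose v23 := p2 * p3 + q2 * q3.
  pose de := v23 - v14.
  pose w1 := p2 * p1 + q2 * q1 + (p3 * p4 + q3 * q4).
  pose w2 := q2 * p1 - p2 * q1 + (q3 * p4 - p3 * q4).
  exists (v14 + v23).
    have Hp : 0 <= (p1 + p4) ^+ 2 + (q1 + q4) ^+ 2 + (p2 + p3) ^+ 2 + (q2 + q3) ^+ 2.
      by rewrite !addr_ge0 ?sqr_ge0.
    have Hm : 0 <= (p1 - p4) ^+ 2 + (q1 - q4) ^+ 2 + (p2 - p3) ^+ 2 + (q2 - q3) ^+ 2.
      by rewrite !addr_ge0 ?sqr_ge0.
    rewrite /v14 /v23; apply/andP; split; lra.
  rewrite dE.
  have -> : k * (p2 * p1 + q2 * q1) + 2 * (p3 * p2 + q3 * q2) +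
      k * (p4 * p3 + q4 * q3) - (v14 + v23) = de + k * w1.
    by rewrite /de /w1 /v14 /v23; ring.
  have -> : l * (q2 * p1 - p2 * q1) + 0 * (q3 * p2 - p3 * q2) +
      - l * (q4 * p3 - p4 * q3) = l * w2 by rewrite /w2; ring.
  have Hs : 4 * (de ^+ 2 + w1 ^+ 2 + w2 ^+ 2) <= 1.
    rewrite -subr_ge0 -[X in X - _](expr1n _ 2) -[X in X ^+ 2 - _]N.
    have -> : (p1 ^+ 2 + q1 ^+ 2 + p2 ^+ 2 + q2 ^+ 2 + p3 ^+ 2 + q3 ^+ 2
        + p4 ^+ 2 + q4 ^+ 2) ^+ 2 - 4 * (de ^+ 2 + w1 ^+ 2 + w2 ^+ 2)
      = (p1 ^+ 2 + q1 ^+ 2 - p4 ^+ 2 - q4 ^+ 2 - p2 ^+ 2 - q2 ^+ 2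
          + p3 ^+ 2 + q3 ^+ 2) ^+ 2
        + 4 * ((q4 * p1 - p4 * q1) - (q3 * p2 - p3 * q2)) ^+ 2.
      by rewrite /de /w1 /w2 /v14 /v23; ring.
    by rewrite addr_ge0 ?sqr_ge0 // mulr_ge0 ?sqr_ge0.
  apply: le_trans Hs; rewrite ler_pM2l // exprMn [l ^+ 2 * _]mulrC.
  rewrite mulfK ?expf_neq0 // lerD2r ler_pdivrMr // -subr_ge0.
  have -> : (de ^+ 2 + w1 ^+ 2) * (1 + k ^+ 2) - (de + k * w1) ^+ 2
    = (k * de - w1) ^+ 2 by ring.
  exact: sqr_ge0.
- case=> v /andP[v1 v2]; rewrite dE => Hd.
  have [a [b [c [N1 EX EY]]]] := disk_spinor _ k l _ _ l0 Hd.
  (* Recentered, the antisymmetric block is unitarily similar to the opposite of the symmetric one;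
     hence the opposite point here and the signs of [b'], [c'] in the witness. *)
  have Hd' : 4 * ((- (x - v)) ^+ 2 / (1 + k ^+ 2) + (- y) ^+ 2 / l ^+ 2) <= 1.
    by rewrite !sqrrN.
  have [a' [b' [c' [N2 EX' EY']]]] := disk_spinor _ k l _ _ l0 Hd'.
  (* The two parts get squared norms 1/2 + v and 1/2 - v; the factor 2 appears because each part is
     written twice, in mirrored coordinates. *)
  pose s := Num.sqrt ((1 / 2 + v) / 2); pose s' := Num.sqrt ((1 / 2 - v) / 2).
  have s2 : s ^+ 2 = (1 / 2 + v) / 2 by rewrite sqr_sqrtr //; lra.
  have s'2 : s' ^+ 2 = (1 / 2 - v) / 2 by rewrite sqr_sqrtr //; lra.
  exists (s * a + s' * a'), 0, (s * b - s' * b'), (s * c - s' * c'),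
    (s * b + s' * b'), (s * c + s' * c'), (s * a - s' * a'), 0.
  split.
  + transitivity (2 * s ^+ 2 * (a ^+ 2 + b ^+ 2 + c ^+ 2)
      + 2 * s' ^+ 2 * (a' ^+ 2 + b' ^+ 2 + c' ^+ 2)); first by ring.
    by rewrite N1 N2 s2 s'2; field.
  + transitivity (2 * s ^+ 2 * (b ^+ 2 + c ^+ 2 - 1 / 2 + k * (a * b) + 1 / 2)
      - 2 * s' ^+ 2 * (b' ^+ 2 + c' ^+ 2 - 1 / 2 + k * (a' * b') + 1 / 2));
      last by field.
    by rewrite -EX -EX' s2 s'2; field.
  + transitivity (2 * s ^+ 2 * (l * (a * c)) - 2 * s' ^+ 2 * (l * (a' * c')));
      last by ring.
    by rewrite -EY -EY' s2 s'2; field.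
Qed.

(** * Conditions on [a_j] and [A_j] in terms of the square of a_j - 1 / a_j *)

Lemma sqr_subV_eq0 (R : realType) (a : R) : 0 < a ->
  (a - a^-1) ^+ 2 = 0 <-> a = 1.
Proof.
move=> a0; have a_neq0 := lt0r_neq0 a0; split=> [/eqP|->].
  rewrite sqrf_eq0 subr_eq0 => /eqP E.
  have a2 : a ^+ 2 = 1 by rewrite expr2 {1}E mulVf.
  by apply/eqP; rewrite -(@eqrXn2 _ 2) ?expr1n ?a2 // ltW.
by rewrite invr1 subrr expr0n.
Qed.

(** The map x - 1/x is injective on the positive reals, and inverting x changes its sign. *)
Lemma sqr_subV_eq (R : realType) (a b : R) : 0 < a -> 0 < b ->
  (a - a^-1) ^+ 2 = (b - b^-1) ^+ 2 <-> a = b \/ a = b^-1.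
Proof.
move=> a0 b0; have a_neq0 := lt0r_neq0 a0; have b_neq0 := lt0r_neq0 b0.
split=> [/eqP|[->//|->]]; last by rewrite invrK -sqrrN opprB.
rewrite eqf_sqr => /orP[]/eqP E; [left|right].
- have pos : a * b + 1 != 0 by rewrite gt_eqF // addr_gt0 ?mulr_gt0.
  apply/eqP; rewrite -subr_eq0; apply/eqP/(mulIf pos).
  transitivity (((a - a^-1) - (b - b^-1)) * (a * b)); first by field; rewrite b_neq0 a_neq0.
  by rewrite E subrr !mul0r.
- have pos : a + b != 0 by rewrite gt_eqF // addr_gt0.
  apply/eqP; rewrite -subr_eq0; apply/eqP/(mulIf pos).
  transitivity (((a - a^-1) - - (b - b^-1)) * a); first by field; rewrite b_neq0 a_neq0.
  by rewrite E subrr !mul0r.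
Qed.

Lemma sqr_addV (R : realType) (a : R) : 0 < a ->
  (a + a^-1) ^+ 2 = (a - a^-1) ^+ 2 + 4.
Proof. by move=> /lt0r_neq0 a0; field. Qed.

Lemma half_sqr_addV (R : realType) (a : R) : 0 < a ->
  (a ^+ 2 + a ^- 2) / 2 = 1 + (a - a^-1) ^+ 2 / 2.
Proof. by move=> /lt0r_neq0 a0; field. Qed.

Lemma bi_elliptical_sufficient (R : realType) (a1 a3 : R) :
  0 < a1 -> 0 < a3 -> a1 = a3 \/ a1 = a3^-1 -> a1 - a1^-1 != 0 ->
  bi_elliptical (numerical_range (reciprocal_mx a1 1 a3)).
Proof.
move=> a1_gt0 a3_gt0 a13 l0.
have k_ge0 : 0 <= (a1 + a1^-1) ^+ 2 by exact: sqr_ge0.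
apply: (stadium_bi_elliptical _ (Num.sqrt (1 + (a1 + a1^-1) ^+ 2) / 2)
                                (`|a1 - a1^-1| / 2)).
- by rewrite divr_gt0 // sqrtr_gt0 ltr_pwDl.
- by rewrite divr_gt0 // normr_gt0.
move=> x y; apply: (iff_trans (numerical_rangeE _ a1 1 a3 x y)).
rewrite invr1 subrr -[1 + 1]/2.
case: a13 => E.
(* Here l_3 = l_1; the flip of the sign of l_1 leads back to the case a_1 a_3 = 1. *)
- rewrite -E; have l0' : - (a1 - a1^-1) != 0 by rewrite oppr_eq0.
  apply: iff_trans; last first.
    by rewrite -[`|a1 - _|]normrN; exact: (nr4_stadium _ _ _ x y l0').
  rewrite opprK; split; first exact: nr4_flip.
  by move/nr4_flip; rewrite opprK.
- have -> : a3 = a1^-1 by rewrite E invrK.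
  rewrite invrK [a1^-1 + a1]addrC -[a1^-1 - a1]opprB; exact: nr4_stadium.
Qed.

Theorem theorem7 (R : realType) (a1 a2 a3 A1 A2 A3 : R)
    (a1_gt0 : 0 < a1) (a2_gt0 : 0 < a2) (a3_gt0 : 0 < a3)
    (A1_def : A1 = (a1 ^+ 2 + a1 ^- 2) / 2)
    (A2_def : A2 = (a2 ^+ 2 + a2 ^- 2) / 2)
    (A3_def : A3 = (a3 ^+ 2 + a3 ^- 2) / 2) :
  [/\ 1 <= A1, 1 <= A2 & 1 <= A3] /\
  [/\ bi_elliptical (numerical_range (reciprocal_mx a1 a2 a3)) <->
        (A1 = A3 /\ 1 < A3) /\ A2 = 1,
      (A1 = A3 /\ 1 < A3) <->
        (a1 = a3 /\ a3 <> 1) \/ (a1 = a3^-1 /\ a3^-1 <> 1)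
    & A2 = 1 <-> a2 = 1].
Proof.
rewrite half_sqr_addV // in A1_def; rewrite half_sqr_addV // in A2_def.
rewrite half_sqr_addV // in A3_def.
have l1_ge0 := sqr_ge0 (a1 - a1^-1); have l2_ge0 := sqr_ge0 (a2 - a2^-1).
have l3_ge0 := sqr_ge0 (a3 - a3^-1).
have A2E : A2 = 1 <-> a2 = 1.
  by rewrite -(sqr_subV_eq0 _ _ a2_gt0) A2_def; split; lra.
have A13E : A1 = A3 <-> a1 = a3 \/ a1 = a3^-1.
  by rewrite -(sqr_subV_eq _ _ _ a1_gt0 a3_gt0) A1_def A3_def; split; lra.
have A3E : 1 < A3 <-> a3 <> 1.
  rewrite -(sqr_subV_eq0 _ _ a3_gt0) A3_def; split; first by lra.
  by move/eqP => l3_neq0; have : 0 < (a3 - a3^-1) ^+ 2; [rewrite lt_def l3_neq0|lra].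
have V1 : a3^-1 = 1 <-> a3 = 1.
  by split=> [/(congr1 GRing.inv)|->]; rewrite ?invrK invr1.
split; first by split; lra.
split=> //; last by rewrite A13E A3E; tauto.
split.
- have sq := sqr_addV R.
  case/(bi_elliptical_necessary _ _ _ _ _ _ _ _ (sq _ a1_gt0) (sq _ a2_gt0)
    (sq _ a3_gt0) (numerical_rangeE _ a1 a2 a3)) => l13 l1_gt0 l2_0.
  by rewrite A1_def A2_def A3_def; split; [split|]; lra.
- case=> -[A13 A3_gt1] /A2E->.
  apply: bi_elliptical_sufficient => //; first exact/A13E.
  by rewrite -sqrf_eq0 gt_eqF //; lra.
Qed.
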